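(* Let $c>-1$ be a real constant and let $z_n=n+c$ for all integers $n\ge1$. Let $\alpha>\max\{0,c\}$. Define $\zeta_{\mathbf z}(s):=\sum_{n=1}^\infty z_n^{-s}$ for $\mathrm{Re}(s)>1$, $(n;k)_{\mathbf z,\alpha}:=z_n^\alpha\prod_{i=1}^k(z_n-z_i)$ for integers $n\ge1,k\ge0$, and for $k\ge1$ \[ \gamma_k(x):=\frac{1}{z_k-x}\cdot\frac{1}{(k;k-1)_{\mathbf z,\alpha}}+\sum_{n=k+1}^\infty\frac{1}{(n;k)_{\mathbf z,\alpha}}. \] Then there is $\varepsilon>0$ such that for all complex $x$ with $|x|\le\varepsilon$, \[ \sum_{m=0}^\infty\zeta_{\mathbf z}(m+\alpha+1)x^m=\sum_{k=1}^\infty\gamma_k(x)\prod_{\ell=1}^{k-1}(x-z_\ell). \]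
   Context: Empty products equal $1$. *)

(* Defs.v *)
From Stdlib Require Import Reals Lra Lia Psatz List.
From Coquelicot Require Import Coquelicot.
Open Scope R_scope.

Definition Cexp (w : C) : C :=
  (exp (Re w) * cos (Im w), exp (Re w) * sin (Im w)).

(* x ^ w for a real base x > 0 and a complex exponent w, principal value. *)
Definition RCpower (x : R) (w : C) : C := Cexp (w * ln x)%C.

(* Complex analogue of [Series]; see [CSeries_unique] below. *)
Definition CSeries (a : nat -> C) : C :=
  iota (T := C_CompleteNormedModule)
    (fun l => is_series (V := C_NormedModule) a l).

(* [prodR f k] and [prodC f k] are the products f 1 * ... * f k; they are
   equal to 1 when k = 0. *)
Definition prodR (f : nat -> R) (k : nat) : R := Iter.iter_nat Rmult 1 f 1 k.
Definition prodC (f : nat -> C) (k : nat) : C :=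
  Iter.iter_nat Cmult (RtoC 1) f 1 k.

(* Only the values at n >= 1 are relevant. *)
Definition z (c : R) (n : nat) : R := INR n + c.

(* Meaningful for Re s > 1, see [zeta_z_correct]. *)
Definition zeta_z (c : R) (s : C) : C :=
  CSeries (fun j => RCpower (z c (S j)) (- s)%C).

(* The symbol (n;k)_{z,alpha}. *)
Definition symb (c alpha : R) (n k : nat) : R :=
  Rpower (z c n) alpha * prodR (fun i => z c n - z c i) k.

(* Meaningful for k >= 1 and x <> z_k; the sum over n >= k + 1 is reindexed by
   n = k + 1 + j and converges by [ex_series_symb]. *)
Definition gamma (c alpha : R) (k : nat) (x : C) : C :=
  (1 / (z c k - x) * (1 / symb c alpha k (k - 1))
   + RtoC (Series (fun j => 1 / symb c alpha (S k + j) k)%R))%C.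

Lemma CSeries_unique (a : nat -> C) (l : C) :
  is_series (V := C_NormedModule) a l -> CSeries a = l.
Proof.
intros H. unfold CSeries.
apply (iota_unique (V := C_CompleteNormedModule)); [|exact H].
intros y Hy.
exact (filterlim_locally_unique (V := C_NormedModule) _ _ _ Hy H).
Qed.

Lemma CSeries_correct (a : nat -> C) :
  ex_series (V := C_NormedModule) a ->
  is_series (V := C_NormedModule) a (CSeries a).
Proof. intros [l H]. rewrite (CSeries_unique a l H). exact H. Qed.

Lemma pseries_term (a N : R) : 0 < a -> 1 <= N ->
  Rpower (N + 1) (- (1 + a)) <= / a * (Rpower N (- a) - Rpower (N + 1) (- a)).
Proof.
intros Ha HN.
assert (HP : 0 < Rpower (N + 1) (- a)) by apply exp_pos.
assert (E1 : Rpower (N + 1) (- (1 + a)) = Rpower (N + 1) (- a) * / (N + 1)).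
{ replace (- (1 + a)) with (- a + - (1)) by ring.
  rewrite Rpower_plus, (Rpower_Ropp _ 1), Rpower_1 by lra. reflexivity. }
assert (E2 : Rpower N (- a)
  = Rpower (N + 1) (- a) * exp (a * (ln (N + 1) - ln N))).
{ unfold Rpower. rewrite <- exp_plus. f_equal. ring. }
assert (Hl : / (N + 1) <= ln (N + 1) - ln N).
{ assert (Hr : 0 < N / (N + 1)) by (apply Rdiv_lt_0_compat; lra).
  pose proof (exp_ineq1_le (ln (N / (N + 1)))) as H.
  rewrite exp_ln in H by exact Hr.
  rewrite ln_div in H by lra.
  replace (N / (N + 1)) with (1 - / (N + 1)) in H by (field; lra). lra. }
pose proof (exp_ineq1_le (a * (ln (N + 1) - ln N))) as He.
rewrite E1, E2.
apply Rmult_le_reg_l with a; [exact Ha|].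
rewrite <- (Rmult_assoc a (/ a)), Rinv_r, Rmult_1_l by lra.
apply (Rmult_le_compat_l a) in Hl; [|lra].
assert (H := Rmult_le_compat_l _ _ _ (Rlt_le _ _ HP)
  (Rle_trans _ _ _ (Rplus_le_compat_l 1 _ _ Hl) He)).
lra.
Qed.

Lemma ex_series_pseries (a : R) : 0 < a ->
  ex_series (fun j => Rpower (INR j + 1) (- (1 + a))).
Proof.
intros Ha.
assert (B : forall n, sum_n (fun j => Rpower (INR j + 1) (- (1 + a))) n
  <= 1 + / a * (1 - Rpower (INR n + 1) (- a))).
{ induction n as [|n IH].
  - rewrite sum_O. simpl. rewrite Rplus_0_l. unfold Rpower. rewrite ln_1, !Rmult_0_r, exp_0.
    lra.
  - rewrite sum_Sn. unfold plus; simpl plus.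
    assert (HN : 1 <= INR n + 1) by (pose proof (pos_INR n); lra).
    pose proof (pseries_term a (INR n + 1) Ha HN) as H.
    rewrite S_INR. change (plus ?x ?y) with (x + y). simpl in *. lra. }
assert (Hf : ex_finite_lim_seq
  (sum_n (fun j => Rpower (INR j + 1) (- (1 + a))))).
{ apply ex_finite_lim_seq_incr with (1 + / a).
  - intros n. rewrite sum_Sn. change (plus ?x ?y) with (x + y).
    pose proof (exp_pos (- (1 + a) * ln (INR (S n) + 1))).
    unfold Rpower in *. lra.
  - intros n. eapply Rle_trans; [apply B|].
    pose proof (exp_pos (- a * ln (INR n + 1))) as H.
    pose proof (Rinv_0_lt_compat a Ha). unfold Rpower. nra. }
destruct Hf as [l Hl]. exists l. exact Hl.
Qed.

Lemma Rpower_opp_le (x y b : R) : 0 < x <= y -> 0 <= b ->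
  Rpower y (- b) <= Rpower x (- b).
Proof.
intros Hxy Hb. rewrite !Rpower_Ropp. apply Rinv_le_contravar.
- apply exp_pos.
- apply Rle_Rpower_l; lra.
Qed.

Lemma Cmod_Cexp (w : C) : Cmod (Cexp w) = exp (Re w).
Proof.
unfold Cexp, Cmod, fst, snd.
rewrite <- (sqrt_Rsqr (exp (Re w))) by (left; apply exp_pos).
f_equal. pose proof (sin2_cos2 (Im w)) as H. unfold Rsqr in *.
transitivity (exp (Re w) * exp (Re w)
  * (sin (Im w) * sin (Im w) + cos (Im w) * cos (Im w))).
- rewrite sqrt_square by (left; apply exp_pos). ring.
- rewrite H. ring.
Qed.

Lemma Cmod_RCpower (x : R) (w : C) : Cmod (RCpower x w) = Rpower x (Re w).
Proof.
unfold RCpower. rewrite Cmod_Cexp. unfold Rpower. f_equal.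
unfold Re, Cmult, RtoC; simpl; ring.
Qed.

Lemma zeta_z_correct (c : R) (s : C) : -1 < c -> 1 < Re s ->
  is_series (V := C_NormedModule)
    (fun j => RCpower (z c (S j)) (- s)%C) (zeta_z c s).
Proof.
intros Hc Hs. apply CSeries_correct.
apply (ex_series_incr_1 (V := C_NormedModule)).
apply (ex_series_le (V := C_CompleteNormedModule)) with
  (fun j => Rpower (INR j + 1) (- (1 + (Re s - 1)))).
- intros j. change (norm ?u) with (Cmod u). rewrite Cmod_RCpower.
  replace (Re (- s)%C) with (- (1 + (Re s - 1)))
    by (unfold Re, Copp; simpl; ring).
  pose proof (pos_INR j).
  apply Rpower_opp_le; [|lra]. unfold z. rewrite !S_INR. lra.
- apply ex_series_pseries. lra.
Qed.

Lemma prodR_ge (f : nat -> R) (k : nat) : (1 <= k)%nat ->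
  (forall i, (1 <= i <= k)%nat -> 1 <= f i) -> f k <= prodR f k.
Proof.
intros Hk H. destruct k as [|k]; [lia|]. unfold prodR.
assert (Hp : forall m, (m <= k)%nat -> 1 <= Iter.iter_nat Rmult 1 f 1 m).
{ induction m as [|m IH]; intros Hm.
  - unfold Iter.iter_nat; simpl. lra.
  - rewrite (Iter.iter_nat_Chasles Rmult 1) with (m := m);
      [|intros; ring|intros; ring|lia|lia].
    rewrite Iter.iter_nat_point by (intros; ring).
    assert (1 <= f (S m)) by (apply H; lia).
    assert (1 <= Iter.iter_nat Rmult 1 f 1 m) by (apply IH; lia). nra. }
rewrite (Iter.iter_nat_Chasles Rmult 1) with (m := k);
  [|intros; ring|intros; ring|lia|lia].
rewrite Iter.iter_nat_point by (intros; ring).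
assert (1 <= f (S k)) by (apply H; lia).
assert (1 <= Iter.iter_nat Rmult 1 f 1 k) by (apply Hp; lia). nra.
Qed.

Lemma ex_series_symb (c alpha : R) (k : nat) :
  -1 < c -> 0 < alpha -> (1 <= k)%nat ->
  ex_series (fun j => 1 / symb c alpha (S k + j) k).
Proof.
intros Hc Ha Hk.
apply (ex_series_le (V := R_CompleteNormedModule)) with
  (fun j => Rpower (INR j + 1) (- (1 + alpha)));
  [|apply ex_series_pseries; exact Ha].
intros j. change (norm ?u) with (Rabs u).
pose proof (pos_INR j) as Hj.
assert (Hk' : 1 <= INR k) by (apply (le_INR 1); exact Hk).
assert (HP : INR j + 1 <= prodR (fun i => z c (S k + j) - z c i) k).
{ eapply Rle_trans; [|apply prodR_ge; [exact Hk|]].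
  - unfold z. rewrite plus_INR, S_INR. lra.
  - intros i Hi. unfold z. rewrite plus_INR, S_INR.
    assert (INR i <= INR k) by (apply le_INR; lia). lra. }
assert (HQ : Rpower (INR j + 1) alpha <= Rpower (z c (S k + j)) alpha).
{ apply Rle_Rpower_l; [lra|]. unfold z. rewrite plus_INR, S_INR. lra. }
assert (H0 : 0 < Rpower (INR j + 1) alpha) by apply exp_pos.
rewrite Rpower_Ropp, Rpower_plus, Rpower_1 by lra.
unfold symb.
rewrite Rabs_pos_eq.
- unfold Rdiv. rewrite Rmult_1_l. apply Rinv_le_contravar; nra.
- apply Rlt_le, Rdiv_lt_0_compat; nra.
Qed.

Lemma symb_pos (c alpha : R) (k : nat) :
  (1 <= k)%nat -> 0 < symb c alpha k (k - 1).
Proof.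
intros Hk. unfold symb. apply Rmult_lt_0_compat; [apply exp_pos|].
destruct k as [|[|k]]; [lia| |].
- unfold prodR, Iter.iter_nat; simpl. lra.
- replace (S (S k) - 1)%nat with (S k) by lia.
  apply Rlt_le_trans with (z c (S (S k)) - z c (S k)).
  + unfold z. rewrite (S_INR (S k)). lra.
  + apply (prodR_ge (fun i => z c (S (S k)) - z c i)); [lia|].
    intros i Hi. unfold z. rewrite (S_INR (S k)).
    assert (INR i <= INR (S k)) by (apply le_INR; lia). lra.
Qed.

(* Main.v *)
(* Both sides equal l = sum_n z_n^(-alpha) / (z_n - x), and in both cases the
   remainder after K terms is an explicit series over n. On the left it is
   sum_n z_n^(-alpha) (x/z_n)^K / (z_n - x), by the geometric sum. On the right,
   write P_K = prod_(l <= K) (x - z_l); Newton interpolation of 1/(z_n - x) at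
   z_1, ..., z_K gives the remainder sum_(n > K) P_K / ((n;K) (z_n - x)). It
   tends to 0: |x - z_l| <= l + alpha gives |P_K| = O(K! K^alpha), while for
   n = K+1+j one has prod_(i <= K) (n - i) >= K! (j+1) and
   z_n >= K^(1/2) (j+1)^(1/2), so the remainder is
   O(K^(-1/2) sum_j (j+1)^(-3/2)). *)

Require Import Defs.
From Stdlib Require Import Reals Factorial Lra Lia.
From Coquelicot Require Import Coquelicot.
Open Scope R_scope.

(** * Complex series controlled through their remainders *)

Lemma Cmod_sub_sym (u v : C) : Cmod (u - v)%C = Cmod (v - u)%C.
Proof. rewrite <- Cmod_opp. f_equal. ring. Qed.

Lemma Cmod_is_series_le (a : nat -> C) (b : nat -> R) (l : C) (m : R) :
  (forall n, Cmod (a n) <= b n) ->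
  is_series (V := C_NormedModule) a l -> is_series b m -> Cmod l <= m.
Proof.
intros Hab Ha Hb.
apply (is_lim_seq_le (fun n => Cmod (sum_n a n)) (sum_n b) (Cmod l) m).
- intros n. unfold sum_n.
  eapply Rle_trans; [apply (norm_sum_n_m (V := C_NormedModule))|].
  apply sum_n_m_le. exact Hab.
- eapply filterlim_comp; [exact Ha|].
  apply (filterlim_norm (V := C_NormedModule)).
- exact Hb.
Qed.

(* [r K] is a series for the remainder of [a] after its first [K] terms. *)
Lemma is_series_of_remainders (a : nat -> C) (r : nat -> nat -> C) (l : C)
    (B : nat -> R) :
  is_series (V := C_NormedModule) (r 0%nat) l ->
  (forall K v, is_series (V := C_NormedModule) (r K) v ->
    is_series (V := C_NormedModule) (r (S K)) (v - a K)%C) ->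
  (forall K v, is_series (V := C_NormedModule) (r (S K)) v ->
    Cmod v <= B K) ->
  is_lim_seq B 0 ->
  is_series (V := C_NormedModule) a l.
Proof.
intros H0 HS HB Hlim.
(* [sum_n a K] includes the term of index [K], so what is left is the remainder after [S K]
   terms. *)
assert (Hr : forall K,
  is_series (V := C_NormedModule) (r (S K)) (l - sum_n a K)%C).
{ induction K as [|K IH].
  - rewrite sum_O. apply HS, H0.
  - rewrite sum_Sn. change (plus ?u ?v) with (u + v)%C.
    replace (l - (sum_n a K + a (S K)))%C with (l - sum_n a K - a (S K))%C
      by ring.
    apply HS, IH. }
apply (filterlim_locally (U := C_NormedModule)). intros e.
apply is_lim_seq_spec in Hlim. destruct (Hlim e) as [N HN].
exists N. intros n Hn. apply (norm_compat1 (V := C_NormedModule)).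
change (norm ?u) with (Cmod u). change (minus ?u ?v) with (u - v)%C.
rewrite Cmod_sub_sym.
eapply Rle_lt_trans; [apply HB, Hr|].
specialize (HN n Hn). rewrite Rminus_0_r in HN.
eapply Rle_lt_trans; [apply Rle_abs|exact HN].
Qed.

(** * Passage from real to complex, and decay of negative powers *)

Lemma RCpower_RtoC (x s : R) : RCpower x (RtoC s) = RtoC (Rpower x s).
Proof.
unfold RCpower, Rpower. rewrite <- RtoC_mult. unfold Cexp, RtoC; simpl.
now rewrite cos_0, sin_0, Rmult_0_r, Rmult_1_r.
Qed.

Lemma is_series_RtoC (a : nat -> R) (l : R) :
  is_series a l -> is_series (V := C_NormedModule) (fun n => RtoC (a n)) (RtoC l).
Proof.
intros H.
assert (E : forall n, sum_n (G := C_AbelianMonoid) (fun k => RtoC (a k)) n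
  = RtoC (sum_n a n)).
{ induction n as [|n IH]; [now rewrite !sum_O|].
  rewrite !sum_Sn, IH. symmetry. apply RtoC_plus. }
apply (filterlim_locally (U := C_NormedModule)). intros e.
change (is_lim_seq (sum_n a) l) in H. apply is_lim_seq_spec in H.
destruct (H e) as [N HN].
exists N. intros n Hn. apply (norm_compat1 (V := C_NormedModule)).
change (Cmod (Cminus (sum_n (G := C_AbelianMonoid) (fun k => RtoC (a k)) n) (RtoC l))
  < e).
rewrite E, <- RtoC_minus, Cmod_R. now apply HN.
Qed.

Lemma is_series_eq (a b : nat -> C) (l m : C) :
  is_series (V := C_NormedModule) a l -> (forall n, a n = b n) -> l = m ->
  is_series (V := C_NormedModule) b m.
Proof. intros H E <-. exact (is_series_ext _ _ _ E H). Qed.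

Lemma is_lim_seq_Rpower_opp (b : R) : 0 < b ->
  is_lim_seq (fun n => Rpower (INR n + 1) (- b)) 0.
Proof.
intros Hb. unfold Rpower.
apply (filterlim_comp _ _ _ _ exp _ (Rbar_locally m_infty));
  [|exact is_lim_exp_m].
change (is_lim_seq (fun n => - b * ln (INR n + 1)) m_infty).
replace m_infty with (Rbar_mult (- b) p_infty).
- apply is_lim_seq_scal_l.
  apply (filterlim_comp _ _ _ _ ln _ (Rbar_locally p_infty));
    [|exact is_lim_ln_p].
  apply (is_lim_seq_ext (fun n => INR (S n))); [apply S_INR|].
  apply (is_lim_seq_incr_1 INR), is_lim_seq_INR.
- simpl. destruct (Rle_dec 0 (- b)); [exfalso; lra|reflexivity].
Qed.

(** * Finite products and the symbols (n;k) *)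

Lemma prodR_S (f : nat -> R) (k : nat) : prodR f (S k) = prodR f k * f (S k).
Proof.
unfold prodR.
rewrite (Iter.iter_nat_Chasles Rmult 1) with (m := k);
  [|intros; ring|intros; ring|lia|lia].
now rewrite Iter.iter_nat_point by (intros; ring).
Qed.

Lemma prodC_S (f : nat -> C) (k : nat) :
  prodC f (S k) = (prodC f k * f (S k))%C.
Proof.
unfold prodC.
rewrite (Iter.iter_nat_Chasles Cmult (RtoC 1)) with (m := k);
  [|intros; ring|intros; ring|lia|lia].
now rewrite Iter.iter_nat_point by (intros; ring).
Qed.

Lemma prodR_ext (f g : nat -> R) (k : nat) :
  (forall i, f i = g i) -> prodR f k = prodR g k.
Proof.
intros H. induction k as [|k IH]; [reflexivity|].
now rewrite !prodR_S, IH, H.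
Qed.

Lemma symb_S (c alpha : R) (n k : nat) :
  symb c alpha n (S k) = symb c alpha n k * (z c n - z c (S k)).
Proof. unfold symb. rewrite prodR_S. ring. Qed.

(** Recursion of the falling factorial at its first factor, where [prodR_S] works at the last one:
    the factor i = 1 is y, and the others shift by one index. *)
Lemma prodR_sub_shift (y : R) (k : nat) :
  prodR (fun i => y + 1 - INR i) (S k) = y * prodR (fun i => y - INR i) k.
Proof.
induction k as [|k IH].
- rewrite prodR_S. unfold prodR, Iter.iter_nat; simpl. ring.
- rewrite prodR_S, IH, prodR_S, (S_INR (S k)). ring.
Qed.

Lemma prodR_z_sub_S (c : R) (K j : nat) :
  prodR (fun i => z c (S (S K) + j) - z c i) (S K)
  = (INR (S K) + INR j) * prodR (fun i => z c (S K + j) - z c i) K.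
Proof.
rewrite (prodR_ext _ (fun i => (INR (S K) + INR j) + 1 - INR i)).
- rewrite prodR_sub_shift. f_equal. apply prodR_ext. intros i.
  unfold z. rewrite plus_INR. ring.
- intros i. unfold z. rewrite plus_INR, (S_INR (S K)). ring.
Qed.

(** The constant c cancels in z_n - z_i, so the product is (K+1+j)!/j!. It starts at j+1 for K = 0,
    and each step multiplies it by K+2+j, which is at least K+2. *)
Lemma prodR_z_sub_ge (c : R) (K j : nat) :
  INR (fact (S K)) * (INR j + 1)
  <= prodR (fun i => z c (S (S K) + j) - z c i) (S K).
Proof.
pose proof (pos_INR j) as Hj.
induction K as [|K IH]; rewrite prodR_z_sub_S.
- unfold prodR, Iter.iter_nat; simpl. lra.
- rewrite fact_simpl, mult_INR, Rmult_assoc.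
  pose proof (pos_INR (S (S K))). pose proof (pos_INR (fact (S K))).
  apply Rmult_le_compat; [lra|nra|lra|exact IH].
Qed.

Lemma symb_gt0 (c alpha : R) (K j : nat) : 0 < symb c alpha (S K + j) K.
Proof.
unfold symb. apply Rmult_lt_0_compat; [apply exp_pos|].
destruct K as [|K]; [unfold prodR, Iter.iter_nat; simpl; lra|].
eapply Rlt_le_trans; [|apply prodR_z_sub_ge].
apply Rmult_lt_0_compat; [apply INR_fact_lt_0|].
pose proof (pos_INR j); lra.
Qed.

(** Combine e^t >= 1 + t at t = a (ln (x+1) - ln x) with ln (x+1) - ln x >= 1/(x+1). This is the
    induction step for bounding products of factors 1 + a/l by a power. *)
Lemma one_plus_div_le_Rpower (a x : R) : 0 <= a -> 0 < x ->
  Rpower x a * (1 + a / (x + 1)) <= Rpower (x + 1) a.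
Proof.
intros Ha Hx.
assert (Hl : / (x + 1) <= ln (x + 1) - ln x).
{ assert (Hr : 0 < x / (x + 1)) by (apply Rdiv_lt_0_compat; lra).
  pose proof (exp_ineq1_le (ln (x / (x + 1)))) as H.
  rewrite exp_ln, ln_div in H by lra.
  replace (x / (x + 1)) with (1 - / (x + 1)) in H by (field; lra). lra. }
replace (Rpower (x + 1) a)
  with (Rpower x a * exp (a * (ln (x + 1) - ln x)))
  by (unfold Rpower; rewrite <- exp_plus; f_equal; ring).
apply Rmult_le_compat_l; [left; apply exp_pos|].
eapply Rle_trans; [|apply exp_ineq1_le].
unfold Rdiv. nra.
Qed.

(** * Estimates for small x *)

Section Remainders.

Variables (c alpha : R) (x : C).
Hypotheses (hc : -1 < c) (hca : c < alpha) (h0a : 0 < alpha).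
Hypotheses (hx1 : Cmod x <= (1 + c) / 2) (hx2 : Cmod x <= alpha - c).

Lemma z_pos (n : nat) : 0 < z c (S n).
Proof. unfold z. rewrite S_INR. pose proof (pos_INR n). lra. Qed.

Lemma Cmod_le_half_z (n : nat) : Cmod x <= z c (S n) / 2.
Proof. unfold z. rewrite S_INR. pose proof (pos_INR n). lra. Qed.

Lemma Cmod_z_sub_ge (n : nat) : z c (S n) / 2 <= Cmod (z c (S n) - x)%C.
Proof.
pose proof (Cmod_le_half_z n) as H.
pose proof (Cmod_triangle (z c (S n) - x)%C x) as Ht.
replace (z c (S n) - x + x)%C with (RtoC (z c (S n))) in Ht by ring.
rewrite Cmod_R, Rabs_pos_eq in Ht by (left; apply z_pos). lra.
Qed.

Lemma z_sub_neq0 (n : nat) : (z c (S n) - x)%C <> 0.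
Proof.
intros H. pose proof (Cmod_z_sub_ge n) as Hn.
rewrite H, Cmod_0 in Hn. pose proof (z_pos n). lra.
Qed.

(** By [hx2], |x - z_l| <= l + alpha = l (1 + alpha/l). The l's form the factorial, l = 1 leaves 1 +
    alpha, and for l >= 2 the factor 1 + alpha/l is at most (l/(l-1))^alpha, which telescopes. *)
Lemma Cmod_prodC_le (K : nat) :
  Cmod (prodC (fun i => x - RtoC (z c i))%C (S K))
  <= (1 + alpha) * INR (fact (S K)) * Rpower (INR K + 1) alpha.
Proof.
assert (Hf : forall i, Cmod (x - RtoC (z c (S i)))%C <= INR i + 1 + alpha).
{ intros i. eapply Rle_trans; [apply Cmod_triangle|].
  rewrite Cmod_opp, Cmod_R, Rabs_pos_eq by (left; apply z_pos).
  unfold z. rewrite S_INR. lra. }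
induction K as [|K IH].
- rewrite prodC_S, Cmod_mult. specialize (Hf 0%nat).
  change (prodC _ 0) with (RtoC 1). rewrite Cmod_1.
  unfold Rpower. simpl INR in *. rewrite Rplus_0_l, ln_1, Rmult_0_r, exp_0. lra.
- rewrite prodC_S, Cmod_mult, fact_simpl, mult_INR.
  pose proof (pos_INR K) as HK. pose proof (INR_fact_lt_0 (S K)) as HF.
  pose proof (Hf (S K)) as Hs.
  pose proof (one_plus_div_le_Rpower alpha (INR K + 1)
    ltac:(lra) ltac:(lra)) as Hp.
  pose proof (exp_pos (alpha * ln (INR K + 1))) as Hpos.
  fold (Rpower (INR K + 1) alpha) in Hpos.
  rewrite !(S_INR (S K)) in *. rewrite !(S_INR K) in *.
  eapply Rle_trans.
  { apply Rmult_le_compat; [apply Cmod_ge_0|apply Cmod_ge_0|exact IH|exact Hs]. }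
  (* The new factor K+2+alpha is split as (K+2)(1 + alpha/(K+2)): K+2 completes the factorial and
     [Hp] absorbs the rest. *)
  replace ((1 + alpha) * INR (fact (S K)) * Rpower (INR K + 1) alpha
      * (INR K + 1 + 1 + alpha))
    with ((1 + alpha) * ((INR K + 1 + 1) * INR (fact (S K)))
      * (Rpower (INR K + 1) alpha * (1 + alpha / (INR K + 1 + 1))))
    by (field; lra).
  apply Rmult_le_compat_l; [|exact Hp].
  apply Rmult_le_pos; [lra|]. apply Rmult_le_pos; lra.
Qed.

(** * The zeta series *)

(** Closed form of the geometric tail over m >= M of x^m z^(-(m+alpha+1)), where z is
    [z c (S n)]. *)
Definition zeta_remainder (M n : nat) : C :=
  (Rpower (z c (S n)) (- (alpha + INR M)) * x ^ M / (z c (S n) - x))%C.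

(** Since |x| <= z_n/2, both |x/z_n| <= 1/2 and 1/|z_n - x| <= 2/z_n hold. *)
Lemma Cmod_zeta_remainder_le (M n : nat) :
  Cmod (zeta_remainder M n)
  <= 2 * (/ 2) ^ M * Rpower (z c (S n)) (- (1 + alpha)).
Proof.
unfold zeta_remainder.
pose proof (z_pos n) as Hz. pose proof (Cmod_z_sub_ge n) as Hd.
rewrite Cmod_div, Cmod_mult, Cmod_pow, Cmod_R by apply z_sub_neq0.
rewrite Rabs_pos_eq by (left; apply exp_pos).
(* One factor z_n is set apart, to cancel against 1/(z_n/2). *)
replace (- (alpha + INR M)) with (- (1 + alpha) + (1 + - INR M)) by ring.
rewrite !Rpower_plus, Rpower_1, (Rpower_Ropp _ (INR M)), Rpower_pow by lra.
set (p := Rpower _ _). assert (0 < p) by apply exp_pos.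
assert (Hxm : Cmod x ^ M <= (/ 2) ^ M * z c (S n) ^ M).
{ rewrite <- Rpow_mult_distr. apply pow_incr. split; [apply Cmod_ge_0|].
  pose proof (Cmod_le_half_z n). lra. }
assert (HzM : 0 < z c (S n) ^ M) by (apply pow_lt; lra).
assert (Hh : 0 < (/ 2) ^ M) by (apply pow_lt; lra).
unfold Rdiv.
replace (2 * (/ 2) ^ M * p)
  with ((p * (z c (S n) * / z c (S n) ^ M) * ((/ 2) ^ M * z c (S n) ^ M))
    * / (z c (S n) / 2)) by (field; lra).
apply Rmult_le_compat.
- apply Rmult_le_pos; [|apply pow_le, Cmod_ge_0].
  left. apply Rmult_lt_0_compat; [assumption|].
  apply Rmult_lt_0_compat; [assumption|now apply Rinv_0_lt_compat].
- left. apply Rinv_0_lt_compat. lra.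
- apply Rmult_le_compat_l; [|exact Hxm].
  left. apply Rmult_lt_0_compat; [assumption|].
  apply Rmult_lt_0_compat; [assumption|now apply Rinv_0_lt_compat].
- apply Rinv_le_contravar; lra.
Qed.

Lemma ex_series_z_Rpower :
  ex_series (fun n => Rpower (z c (S n)) (- (1 + alpha))).
Proof.
(* The first term is dropped because z_1 = 1 + c may be below 1; after the shift the base is j+2+c >
   j+1. *)
apply (ex_series_incr_1 (V := R_NormedModule)).
apply (ex_series_le (V := R_CompleteNormedModule)) with
  (fun j => Rpower (INR j + 1) (- (1 + alpha)));
  [|now apply ex_series_pseries].
intros j. change (norm ?u) with (Rabs u).
rewrite Rabs_pos_eq by (left; apply exp_pos).
pose proof (pos_INR j).
apply Rpower_opp_le; [|lra]. unfold z. rewrite !S_INR. lra.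
Qed.

Lemma ex_series_zeta_remainder_0 :
  ex_series (V := C_NormedModule) (zeta_remainder 0).
Proof.
apply (ex_series_le (V := C_CompleteNormedModule)) with
  (fun n => 2 * (/ 2) ^ 0 * Rpower (z c (S n)) (- (1 + alpha))).
- intros n. apply Cmod_zeta_remainder_le.
- apply (ex_series_scal (V := R_NormedModule) (2 * (/ 2) ^ 0)), ex_series_z_Rpower.
Qed.

(** Remainder M passes to M+1 by 1/(z_n - x) - 1/z_n = x/(z_n (z_n - x)); summed over n, the part
    removed is the M-th term of the power series. *)
Lemma is_series_zeta (l : C) :
  is_series (V := C_NormedModule) (zeta_remainder 0) l ->
  is_series (V := C_NormedModule)
    (fun m => zeta_z c (RtoC (INR m + alpha + 1)) * x ^ m)%C l.
Proof.
intros Hl. destruct ex_series_z_Rpower as [Z HZ].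
apply (is_series_of_remainders _ zeta_remainder l
  (fun M => 2 * (/ 2) ^ S M * Z)); [exact Hl| | |].
- intros M v Hv.
  assert (Hs : 1 < Re (RtoC (INR M + alpha + 1)))
    by (simpl; pose proof (pos_INR M); lra).
  pose proof (zeta_z_correct c _ hc Hs) as Hzeta.
  apply (is_series_scal (V := C_NormedModule) (x ^ M)%C) in Hzeta.
  pose proof (is_series_minus (V := C_NormedModule) _ _ _ _ Hv Hzeta) as H.
  apply (is_series_eq _ _ _ _ H); [intros n|].
  2: { change (v - x ^ M * zeta_z c (RtoC (INR M + alpha + 1))
         = v - zeta_z c (RtoC (INR M + alpha + 1)) * x ^ M)%C. ring. }
  change (zeta_remainder M n
    - x ^ M * RCpower (z c (S n)) (- RtoC (INR M + alpha + 1))%C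
    = zeta_remainder (S M) n)%C.
  rewrite <- RtoC_opp, RCpower_RtoC. unfold zeta_remainder.
  rewrite Cpow_S, S_INR.
  pose proof (z_pos n) as Hz.
  replace (- (alpha + INR M)) with (- (INR M + alpha + 1) + 1) by ring.
  replace (- (alpha + (INR M + 1))) with (- (INR M + alpha + 1)) by ring.
  rewrite Rpower_plus, Rpower_1, RtoC_mult by exact Hz.
  field. apply z_sub_neq0.
- intros M v Hv.
  apply (Cmod_is_series_le _ _ _ _ (Cmod_zeta_remainder_le (S M)) Hv).
  now apply (is_series_scal (V := R_NormedModule) (2 * (/ 2) ^ S M)).
- apply (is_lim_seq_ext (fun M => (/ 2) ^ M * Z)).
  { intros M. simpl. field. }
  replace (Finite 0) with (Rbar_mult 0 Z) by (simpl; f_equal; ring).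
  apply is_lim_seq_scal_r, is_lim_seq_geom.
  rewrite Rabs_pos_eq; lra.
Qed.

(** * The Newton series *)

(** The index j stands for n = K+1+j: for 1 <= n <= K the point z_n is already a node and (n;K)
    vanishes. *)
Definition newton_remainder (K j : nat) : C :=
  (prodC (fun i => x - RtoC (z c i)) K
   / (symb c alpha (S K + j) K * (z c (S K + j) - x)))%C.

(** With no node used yet, both expansions start from z_n^(-alpha)/(z_n - x), hence have the same
    sum. *)
Lemma newton_remainder_0 (j : nat) :
  newton_remainder 0 j = zeta_remainder 0 j.
Proof.
assert (Hp : 0 < Rpower (z c (S j)) alpha) by apply exp_pos.
unfold newton_remainder, zeta_remainder, symb, prodC, prodR, Iter.iter_nat.
simpl. change (INR (S j) + c) with (z c (S j)).
rewrite Rplus_0_r, Rmult_1_r, Rpower_Ropp, RtoC_inv by lra.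
field. split; [|apply z_sub_neq0].
intros H. apply RtoC_inj in H. lra.
Qed.

(** The factorial and the power (K+1)^alpha cancel between numerator and denominator, leaving 2
    (1+alpha)/((j+1) z_n). Since z_n >= K+1 and z_n >= j+1, writing z_n as the square of its root
    gives both decay in K and summability in j. *)
Lemma Cmod_newton_remainder_le (K j : nat) :
  Cmod (newton_remainder (S K) j)
  <= 2 * (1 + alpha) * Rpower (INR K + 1) (- (/ 2))
     * Rpower (INR j + 1) (- (1 + / 2)).
Proof.
unfold newton_remainder.
assert (Hz : INR K + 1 + INR j < z c (S (S K) + j))
  by (unfold z; rewrite plus_INR, !S_INR; lra).
pose proof (pos_INR K) as HK. pose proof (pos_INR j) as Hj.
pose proof (Cmod_z_sub_ge (S K + j)) as Hd.
change (S (S K + j)) with (S (S K) + j)%nat in Hd.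
pose proof (z_sub_neq0 (S K + j)) as Hx0.
change (S (S K + j)) with (S (S K) + j)%nat in Hx0.
pose proof (symb_gt0 c alpha (S K) j) as Hs.
pose proof (prodR_z_sub_ge c K j) as HD.
pose proof (Cmod_prodC_le K) as HP.
pose proof (INR_fact_lt_0 (S K)) as HF.
assert (Hs0 : RtoC (symb c alpha (S (S K) + j) (S K)) <> 0)
  by (intros H; apply RtoC_inj in H; lra).
rewrite Cmod_div by (apply Cmult_neq_0; assumption).
rewrite Cmod_mult, Cmod_R, Rabs_pos_eq by lra.
unfold symb in *.
set (zn := z c (S (S K) + j)) in *.
set (D := prodR _ _) in *. set (F := INR (fact (S K))) in *.
set (d := Cmod (zn - x)%C) in *.
rewrite (Rpower_Ropp _ (/ 2)), (Rpower_Ropp _ (1 + / 2)), Rpower_plus,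
  Rpower_1 by lra.
assert (Hzp : Rpower (INR K + 1) alpha <= Rpower zn alpha)
  by (apply Rle_Rpower_l; lra).
assert (Hza : Rpower (INR K + 1) (/ 2) <= Rpower zn (/ 2))
  by (apply Rle_Rpower_l; lra).
assert (Hzb : Rpower (INR j + 1) (/ 2) <= Rpower zn (/ 2))
  by (apply Rle_Rpower_l; lra).
assert (Hzz : Rpower zn (/ 2) * Rpower zn (/ 2) = zn).
{ rewrite <- Rpower_plus. replace (/ 2 + / 2) with 1 by field.
  apply Rpower_1. lra. }
assert (Hp0 : 0 < Rpower (INR K + 1) alpha) by apply exp_pos.
assert (Ha0 : 0 < Rpower (INR K + 1) (/ 2)) by apply exp_pos.
assert (Hb0 : 0 < Rpower (INR j + 1) (/ 2)) by apply exp_pos.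
set (p := Rpower (INR K + 1) alpha) in *.
set (a := Rpower (INR K + 1) (/ 2)) in *.
set (b := Rpower (INR j + 1) (/ 2)) in *.
assert (Hab : a * b <= zn)
  by (rewrite <- Hzz; apply Rmult_le_compat; lra).
assert (Hab0 : 0 < a * b) by (apply Rmult_lt_0_compat; assumption).
assert (HFJ : 0 < F * (INR j + 1)) by (apply Rmult_lt_0_compat; lra).
(* The target is expanded by F p, so that numerator and denominator can be compared factor by
   factor. *)
replace (2 * (1 + alpha) * / a * / ((INR j + 1) * b))
  with ((1 + alpha) * F * p * / (p * (F * (INR j + 1)) * (a * b / 2)))
  by (field; repeat split; lra).
apply Rmult_le_compat.
- apply Cmod_ge_0.
- left. apply Rinv_0_lt_compat, Rmult_lt_0_compat; lra.
- exact HP.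
- apply Rinv_le_contravar.
  + repeat apply Rmult_lt_0_compat; lra.
  + apply Rmult_le_compat; [apply Rmult_le_pos; lra|lra| |lra].
    apply Rmult_le_compat; lra.
Qed.

(** Remainder K passes to K+1 in two moves. The term n = K+1 gives the first summand of gamma_(K+1).
    For n > K+1, 1/((n;K)(z_n - x)) - 1/(n;K+1) = (x - z_(K+1))/((n;K+1)(z_n - x)), and the
    subtracted terms give the second summand. *)
Lemma is_series_newton (l : C) :
  is_series (V := C_NormedModule) (newton_remainder 0) l ->
  is_series (V := C_NormedModule)
    (fun j => gamma c alpha (S j) x
      * prodC (fun i => x - RtoC (z c i)) (S j - 1))%C l.
Proof.
intros Hl.
destruct (ex_series_pseries (/ 2) ltac:(lra)) as [Z HZ].
apply (is_series_of_remainders _ newton_remainder l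
  (fun K => 2 * (1 + alpha) * Rpower (INR K + 1) (- (/ 2)) * Z));
  [exact Hl| | |].
- intros K v Hv.
  set (P := prodC (fun i => x - RtoC (z c i))%C K).
  assert (Hg : is_series (V := C_NormedModule)
    (fun j => P * RtoC (1 / symb c alpha (S (S K) + j) (S K)))%C
    (P * RtoC (Series (fun j => 1 / symb c alpha (S (S K) + j) (S K))%R))%C).
  { apply (is_series_scal (V := C_NormedModule) P).
    apply is_series_RtoC, Series_correct, ex_series_symb; [exact hc|exact h0a|lia]. }
  assert (Hv1 : is_series (V := C_NormedModule)
    (fun j => newton_remainder K (S j)) (v - newton_remainder K 0)%C).
  { apply (is_series_incr_1 (V := C_NormedModule)).
    apply (is_series_eq _ _ _ _ Hv); [reflexivity|].
    change ((v : C) = v - newton_remainder K 0 + newton_remainder K 0)%C. ring. }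
  pose proof (is_series_minus (V := C_NormedModule) _ _ _ _ Hv1 Hg) as H.
  apply (is_series_eq _ _ _ _ H).
  + intros j.
    change (newton_remainder K (S j)
      - P * RtoC (1 / symb c alpha (S (S K) + j) (S K))
      = newton_remainder (S K) j)%C.
    unfold newton_remainder. rewrite prodC_S, Nat.add_succ_r. fold P.
    change (S (S K + j)) with (S (S K) + j)%nat.
    pose proof (symb_gt0 c alpha (S K) j) as Hs.
    pose proof (z_sub_neq0 (S K + j)) as Hx0.
    change (S (S K + j)) with (S (S K) + j)%nat in Hx0.
    (* [Hs] becomes positivity of (n;K)(z_n - z_(K+1)), so neither factor is zero. *)
    rewrite symb_S in *.
    set (s := symb _ _ _ _) in *. set (zn := z c (S (S K) + j)) in *.
    rewrite RtoC_div, RtoC_mult, RtoC_minus by lra.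
    assert (Hs0 : RtoC s <> 0)
      by (intros E; apply RtoC_inj in E; rewrite E in Hs; lra).
    assert (Hd0 : (zn - z c (S K))%C <> 0).
    { rewrite <- RtoC_minus. intros E. apply RtoC_inj in E.
      rewrite E in Hs; lra. }
    field. repeat split; assumption.
  + change (v - newton_remainder K 0
      - P * RtoC (Series (fun j => 1 / symb c alpha (S (S K) + j) (S K))%R)
      = v - gamma c alpha (S K) x
        * prodC (fun i => x - RtoC (z c i)) (S K - 1))%C.
    unfold gamma, newton_remainder.
    replace (S K - 1)%nat with K by lia. rewrite Nat.add_0_r. fold P.
    pose proof (symb_gt0 c alpha K 0) as Hs. rewrite Nat.add_0_r in Hs.
    assert (Hs0 : RtoC (symb c alpha (S K) K) <> 0)
      by (intros E; apply RtoC_inj in E; lra).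
    field. split; [exact Hs0|apply z_sub_neq0].
- intros K v Hv.
  apply (Cmod_is_series_le _ _ _ _ (Cmod_newton_remainder_le K) Hv).
  now apply (is_series_scal (V := R_NormedModule)).
- apply (is_lim_seq_ext (fun K => 2 * (1 + alpha) * Z * Rpower (INR K + 1) (- (/ 2)))).
  { intros K. ring. }
  replace (Finite 0) with (Rbar_mult (2 * (1 + alpha) * Z) 0)
    by (simpl; f_equal; ring).
  apply is_lim_seq_scal_l, is_lim_seq_Rpower_opp. lra.
Qed.

End Remainders.

(* Both series are asserted to converge, to the same sum; the outer sum over
   k >= 1 is reindexed by k = S j. *)
Theorem theorem2p5 (c alpha : R) (hc : -1 < c) (halpha : Rmax 0 c < alpha) :
  exists eps : R, 0 < eps /\
    forall x : C, Cmod x <= eps ->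
      exists l : C,
        is_series (V := C_NormedModule)
          (fun m : nat => (zeta_z c (RtoC (INR m + alpha + 1)) * x ^ m)%C) l /\
        is_series (V := C_NormedModule)
          (fun j : nat =>
             (gamma c alpha (S j) x
              * prodC (fun i : nat => x - RtoC (z c i)) (S j - 1))%C) l.
Proof.
assert (h0a : 0 < alpha) by (pose proof (Rmax_l 0 c); lra).
assert (hca : c < alpha) by (pose proof (Rmax_r 0 c); lra).
(* The first bound is z_1/2, which keeps |x| <= z_n/2 for all n >= 1; the second gives |x - z_l| <=
   l + alpha. *)
exists (Rmin ((1 + c) / 2) (alpha - c)). split; [apply Rmin_case; lra|].
intros x Hx.
assert (hx1 : Cmod x <= (1 + c) / 2)
  by (eapply Rle_trans; [exact Hx|apply Rmin_l]).
assert (hx2 : Cmod x <= alpha - c)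
  by (eapply Rle_trans; [exact Hx|apply Rmin_r]).
destruct (ex_series_zeta_remainder_0 c alpha x hc h0a hx1) as [l Hl].
exists l. split.
- now apply is_series_zeta.
- apply is_series_newton; try assumption.
  eapply is_series_ext; [|exact Hl].
  intros j. symmetry. now apply newton_remainder_0.
Qed.
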